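(* For all integrable cones $B,C$ and all $x\in B$, $y\in C$, one has $\|x\otimes y\|=\|x\|\,\|y\|$.
   Context: Cones. A precone is a module $P$ over $\mathbb{R}_{\ge 0}$ with $x_1+x=x_2+x\Rightarrow x_1=x_2$ and $x_1+x_2=0\Rightarrow x_1=0$, ordered by $x\le y$ iff $y=x+z$ for some $z$. A cone is a precone with $\|\cdot\|:P\to\mathbb{R}_{\ge0}$ such that $\|\lambda x\|=\lambda\|x\|$, $\|x\|=0\Rightarrow x=0$, $\|x+y\|\le\|x\|+\|y\|$, $\|x\|\le\|x+y\|$, and every increasing sequence in $\mathcal{B}P=\{x:\|x\|\le 1\}$ has a lub in $P$ lying in $\mathcal{B}P$. Continuous = monotone and preserving lubs of norm-bounded increasing sequences; $\|f\|=\sup_{x\in\mathcal{B}P}\|f(x)\|$; $P'$ = cone of linear continuous maps $P\to\mathbb{R}_{\ge0}$. Measurability. Fix a small full subcategory $\mathbf{Ar}$ of measurable spaces, closed under binary products, containing the one-point space $0$, with non-empty objects. A measurability structure on $P$ is a family $(\mathcal{M}_X)_{X\in\mathbf{Ar}}$ of sets of maps $m:X\times P\to\mathbb{R}_{\ge0}$ with $m(r,\cdot)\in P'$ such that: (i) $r\mapsto m(r,x)$ measurable into $[0,1]$ for $x\in\mathcal{B}P$; (ii) $(s,x)\mapsto m(\phi(s),x)\in\mathcal{M}_Y$ for $\phi\in\mathbf{Ar}(Y,X)$; (iii) $\mathcal{M}_0$ separates points; (iv) $\|x\|=\sup\{m(x)/\|m\|:m\in\mathcal{M}_0\setminus\{0\}\}$.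 Paths of arity $X$: bounded $\gamma:X\to C$ with $(s,r)\mapsto m(s,\gamma(r))$ measurable for all $m\in\mathcal{M}_Y$. Integral over finite $\mu$: the $x$ with $m(x)=\int m(\gamma(r))\mu(dr)$ for all $m\in\mathcal{M}_0$. Integrable cone: all such integrals exist. $\mathbf{ICones}$: integrable cones with linear, continuous, norm $\le1$, measurable, integral-preserving maps. Linear hom: $C\multimap D$ is the integrable cone of maps $f$ with $\epsilon f\in\mathbf{ICones}(C,D)$ for some $\epsilon>0$, pointwise operations, norm $\sup_{x\in\mathcal{B}C}\|f(x)\|$, tests $(r,f)\mapsto m(r,f(\gamma(r)))$ for $\gamma$ a path of arity $X$ in $C$, $m\in\mathcal{M}^D_X$; it is functorial by pre/post-composition. Tensor: for each $C$, $C\multimap -$ has a left adjoint $-\otimes C$, extending to a bifunctor with natural bijections $\Phi_{B,C,D}:\mathbf{ICones}(B\otimes C,D)\to\mathbf{ICones}(B,C\multimap D)$; for $x\in B,y\in C$, $x\otimes y:=\Phi_{B,C,B\otimes C}(\mathrm{id})(x)(y)\in B\otimes C$. *)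

(* Defs.v *)
From HB Require Import structures.
From mathcomp Require Import all_boot all_order all_algebra.
From mathcomp Require Import all_classical all_reals all_analysis.
From mathcomp Require Import measurable_realfun.

Set Implicit Arguments.
Unset Strict Implicit.
Unset Printing Implicit Defensive.

Import Order.TTheory GRing.Theory Num.Theory.
Import numFieldNormedType.Exports.

Local Open Scope classical_set_scope.
Local Open Scope ring_scope.

(** ** The semiring of non-negative reals *)

Record nnreal (R : realType) := NNReal {
  nnval :> R;
  nnvalP : nnval \is Num.nneg }.

Section nnreal.
Variable R : realType.

HB.instance Definition _ := [isSub for @nnval R].
HB.instance Definition _ := [Choice of nnreal R by <:].
HB.instance Definition _ := [SubChoice_isSubComNzSemiRing of nnreal R by <:].

Lemma nnval_ge0 (a : nnreal R) : 0 <= nnval a.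
Proof. exact: nnvalP. Qed.

Lemma nnval_inj : injective (@nnval R).
Proof. exact: val_inj. Qed.

Lemma nnvalD (a b : nnreal R) : nnval (a + b) = nnval a + nnval b.
Proof. exact: (raddfD (\val : nnreal R -> R)). Qed.

Lemma nnval0 : nnval (0 : nnreal R) = 0.
Proof. exact: (raddf0 (\val : nnreal R -> R)). Qed.

Lemma nnvalM (a b : nnreal R) : nnval (a * b) = nnval a * nnval b.
Proof. exact: (rmorphM (\val : nnreal R -> R)). Qed.

Lemma nnval1 : nnval (1 : nnreal R) = 1.
Proof. exact: (rmorph1 (\val : nnreal R -> R)). Qed.

Definition nnreal_of (r : R) (r0 : 0 <= r) : nnreal R := @NNReal R r r0.

End nnreal.

(** ** Cones *)

HB.mixin Record LSemiModule_isPrecone (R : realType) P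
    of GRing.LSemiModule (nnreal R) P := {
  addcI : forall x x1 x2 : P, x1 + x = x2 + x -> x1 = x2;
  addc_eq0l : forall x1 x2 : P, x1 + x2 = 0 -> x1 = 0
}.

#[short(type="preconeType")]
HB.structure Definition Precone (R : realType) :=
  {P of LSemiModule_isPrecone R P & GRing.LSemiModule (nnreal R) P}.

Definition cle (R : realType) (P : preconeType R) (x y : P) :=
  exists z, y = x + z.

Definition cincr (R : realType) (P : preconeType R) (u : nat -> P) :=
  forall n, cle (u n) (u n.+1).

Definition is_club (R : realType) (P : preconeType R) (u : nat -> P) (l : P) :=
  (forall n, cle (u n) l) /\ (forall y, (forall n, cle (u n) y) -> cle l y).

(* The norm is [R]-valued; its non-negativity follows from the axioms
   (lemma [cnorm_ge0]). *)
HB.mixin Record Precone_isCone (R : realType) P of Precone R P := {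
  cnorm : P -> R;
  cnormZ : forall (a : nnreal R) (x : P), cnorm (a *: x) = nnval a * cnorm x;
  cnorm0_eq0 : forall x : P, cnorm x = 0 -> x = 0;
  cnormD : forall x y : P, cnorm (x + y) <= cnorm x + cnorm y;
  cnorm_leD : forall x y : P, cnorm x <= cnorm (x + y);
  cball_lub : forall u : nat -> P, cincr u -> (forall n, cnorm (u n) <= 1) ->
    exists2 l, is_club u l & cnorm l <= 1
}.

#[short(type="coneType")]
HB.structure Definition Cone (R : realType) :=
  {P of Precone_isCone R P & Precone R P}.

Definition cball (R : realType) (P : coneType R) : set P :=
  [set x | cnorm x <= 1].

Definition cbounded (R : realType) (P : coneType R) (T : Type) (u : T -> P) :=
  exists M : R, forall t, cnorm (u t) <= M.

Definition copnorm (R : realType) (P Q : coneType R) (f : P -> Q) : R :=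
  sup [set cnorm (f x) | x in @cball R P].

Definition clinear (R : realType) (P Q : coneType R) (f : P -> Q) :=
  (forall (a : nnreal R) x, f (a *: x) = a *: f x) /\
  (forall x y, f (x + y) = f x + f y).

Definition ccontinuous (R : realType) (P Q : coneType R) (f : P -> Q) :=
  (forall x y, cle x y -> cle (f x) (f y)) /\
  (forall (u : nat -> P) l, cincr u -> cbounded u -> is_club u l ->
    is_club (f \o u) (f l)).

Section cone_theory.
Variables (R : realType).

Section precone.
Variable P : preconeType R.
Implicit Types x y z : P.

Lemma cle_refl x : cle x x.
Proof. by exists 0; rewrite addr0. Qed.

Lemma cle_trans x y z : cle x y -> cle y z -> cle x z.
Proof. by move=> [a ->] [b ->]; exists (a + b); rewrite addrA. Qed.

Lemma cle_anti x y : cle x y -> cle y x -> x = y.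
Proof.
move=> [a ->] [b e]; have ab : a + b = 0.
  by apply: (@addcI _ _ x); rewrite add0r {2}e addrC addrA.
by rewrite (addc_eq0l _ _ ab) addr0.
Qed.

Lemma cle_addr x y : cle x (x + y).
Proof. by exists y. Qed.

Lemma cleD x y x' y' : cle x x' -> cle y y' -> cle (x + y) (x' + y').
Proof. by move=> [a ->] [b ->]; exists (a + b); rewrite addrACA. Qed.

Lemma cleZ a x y : cle x y -> cle (a *: x) (a *: y).
Proof. by move=> [z ->]; exists (a *: z); rewrite scalerDr. Qed.

Lemma cle_addI z x y : cle (z + x) (z + y) -> cle x y.
Proof.
move=> [w e]; suff -> : y = x + w by exact: cle_addr.
by apply: (@addcI _ _ z); rewrite addrC e -addrA addrC.
Qed.

Lemma cincr_le (u : nat -> P) m n : cincr u -> (m <= n)%N -> cle (u m) (u n).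
Proof.
move=> iu /subnK <-; elim: (n - m)%N => [|k IH]; first exact: cle_refl.
by rewrite addSn; apply: cle_trans IH (iu _).
Qed.

Lemma club_uniq (u : nat -> P) l l' : is_club u l -> is_club u l' -> l = l'.
Proof. by move=> [u1 l1] [u2 l2]; apply: cle_anti; [apply: l1|apply: l2]. Qed.

Lemma club_addl (u : nat -> P) x l :
  is_club u l -> is_club (fun n => x + u n) (x + l).
Proof.
move=> [ul lm]; split=> [n|y uy]; first exact: cleD (cle_refl _) (ul n).
have [z yE] : cle x y by apply: cle_trans (uy 0%N); exact: cle_addr.
rewrite yE; apply: cleD; first exact: cle_refl.
by apply: lm => n; apply: (@cle_addI x); rewrite -yE.
Qed.

Lemma clubD (u v : nat -> P) l l' : cincr u -> cincr v ->
  is_club u l -> is_club v l' -> is_club (fun n => u n + v n) (l + l').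
Proof.
move=> iu iv ul vl; split=> [n|y uvy]; first exact: cleD (ul.1 n) (vl.1 n).
apply: (club_addl l vl).2 => m; rewrite addrC.
apply: (club_addl (v m) ul).2 => n.
apply: cle_trans (uvy (maxn m n)); rewrite addrC.
by apply: cleD; apply: cincr_le; rewrite ?leq_maxl ?leq_maxr.
Qed.

End precone.

Section cone.
Variable P : coneType R.
Implicit Types x y z : P.

Lemma cnorm0 : cnorm (0 : P) = 0.
Proof. by rewrite -[X in cnorm X](scale0r (0 : P)) cnormZ nnval0 mul0r. Qed.

Lemma cnorm_ge0 x : 0 <= cnorm x.
Proof. by have := cnorm_leD 0 x; rewrite cnorm0 add0r. Qed.

Lemma cle_cnorm x y : cle x y -> cnorm x <= cnorm y.
Proof. by move=> [z ->]; exact: cnorm_leD. Qed.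

Lemma nnreal_inv (r : R) : 0 < r -> exists a b : nnreal R,
  [/\ nnval a = r, nnval b = r^-1, b * a = 1 & a * b = 1].
Proof.
move=> r0; have ri : 0 <= r^-1 by rewrite invr_ge0 ltW.
exists (nnreal_of (ltW r0)), (nnreal_of ri).
by split => //; apply: nnval_inj; rewrite nnvalM nnval1 /= ?mulVf ?mulfV ?gt_eqF.
Qed.

Lemma clubZ a (u : nat -> P) l :
  is_club u l -> is_club (fun n => a *: u n) (a *: l).
Proof.
move=> [ul lm]; split=> [n|y uy]; first exact: cleZ.
have [a0|a0] := eqVneq (nnval a) 0.
  have -> : a = 0 by apply: nnval_inj; rewrite nnval0.
  by rewrite scale0r; exists y; rewrite add0r.
have ap : 0 < nnval a by rewrite lt_neqAle eq_sym a0 nnval_ge0.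
have [a' [b [aE bE ba ab]]] := nnreal_inv ap.
have {}aE : a' = a by exact: nnval_inj.
subst a'; rewrite -[y]scale1r -ab -scalerA; apply: cleZ; apply: lm => n.
by rewrite -[u n]scale1r -ba -scalerA; apply: cleZ.
Qed.

Lemma cincrZ a (u : nat -> P) : cincr u -> cincr (fun n => a *: u n).
Proof. by move=> iu n; apply: cleZ. Qed.

Lemma cbound_lub (u : nat -> P) M : 0 <= M -> cincr u ->
  (forall n, cnorm (u n) <= M) -> exists2 l, is_club u l & cnorm l <= M.
Proof.
move=> M0 iu uM; have [M00|Mn0] := eqVneq M 0.
  exists 0; last by rewrite cnorm0.
  have u0 n : u n = 0.
    by apply: cnorm0_eq0; apply/eqP; rewrite eq_le cnorm_ge0 -M00 uM.
  by split=> [n|y _]; [rewrite u0; exact: cle_refl|exists y; rewrite add0r].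
have Mp : 0 < M by rewrite lt_neqAle eq_sym Mn0.
have [a [b [aE bE ba ab]]] := nnreal_inv Mp.
have [||l ul l1] := @cball_lub _ P (fun n => b *: u n).
- exact: cincrZ.
- by move=> n; rewrite cnormZ bE ler_pdivrMl// mulr1.
exists (a *: l); last by rewrite cnormZ aE ler_piMr.
have := clubZ a ul; congr (is_club _ _); apply/funext => n.
by rewrite scalerA ab scale1r.
Qed.

Lemma cbound_lub_le (u : nat -> P) M l : cincr u ->
  (forall n, cnorm (u n) <= M) -> is_club u l -> cnorm l <= M.
Proof.
move=> iu uM ul; have M0 : 0 <= M by exact: le_trans (cnorm_ge0 _) (uM 0%N).
by have [l' ul' ?] := cbound_lub M0 iu uM; rewrite (club_uniq ul ul').
Qed.

Lemma cnorm_inv x : x != 0 -> exists a b : nnreal R,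
  [/\ nnval a = cnorm x, nnval b = (cnorm x)^-1, b * a = 1, a * b = 1 &
      cnorm (b *: x) = 1].
Proof.
move=> x0; have n0 : cnorm x != 0 by apply: contra_neq x0 => /cnorm0_eq0.
have np : 0 < cnorm x by rewrite lt_neqAle eq_sym n0 cnorm_ge0.
have [a [b [aE bE ba ab]]] := nnreal_inv np.
by exists a, b; split; rewrite // cnormZ bE mulVf.
Qed.

End cone.
End cone_theory.

(** ** The cone of non-negative reals *)

Section nnreal_cone.
Variable R : realType.
Local Notation nn := (nnreal R)^o.
Implicit Types x y : nn.

Let nn_addcI x x1 x2 : x1 + x = x2 + x -> x1 = x2.
Proof.
by move=> /(congr1 (@nnval R)); rewrite !nnvalD => /addIr /nnval_inj.
Qed.

Let nn_addc_eq0l x1 x2 : x1 + x2 = 0 -> x1 = 0.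
Proof.
move=> /(congr1 (@nnval R)); rewrite nnvalD nnval0 => /eqP.
rewrite paddr_eq0 ?nnval_ge0// => /andP[/eqP x0 _].
by apply: nnval_inj; rewrite x0 nnval0.
Qed.

HB.instance Definition _ :=
  LSemiModule_isPrecone.Build R nn nn_addcI nn_addc_eq0l.

Lemma nn_cleE x y : cle x y <-> nnval x <= nnval y.
Proof.
split=> [[z ->]|xy]; first by rewrite nnvalD lerDl nnval_ge0.
have d : 0 <= nnval y - nnval x by rewrite subr_ge0.
by exists (nnreal_of d); apply: nnval_inj; rewrite nnvalD /= addrC subrK.
Qed.

Let nn_ball_lub (u : nat -> nn) : cincr u -> (forall n, nnval (u n) <= 1) ->
  exists2 l, is_club u l & nnval l <= 1.
Proof.
move=> iu u1; pose S := [set nnval (u n) | n in [set: nat]].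
have hS : has_sup S.
  by split; [exists (nnval (u 0%N)), 0%N|exists 1 => _ [n _ <-]].
have uS n : nnval (u n) <= sup S by apply: sup_upper_bound => //; exists n.
have S0 : 0 <= sup S by apply: le_trans (uS 0%N); exact: nnval_ge0.
exists (nnreal_of S0).
  split=> [n|y uy]; apply/nn_cleE => //=.
  by apply: ge_sup => [|_ [n _ <-]]; [case: hS|apply/nn_cleE].
by apply: ge_sup => [|_ [n _ <-]//]; case: hS.
Qed.

Let nn_cnormZ (a : nnreal R) x : nnval (a *: x) = nnval a * nnval x.
Proof. exact: nnvalM. Qed.

Let nn_cnorm0_eq0 x : nnval x = 0 -> x = 0.
Proof. by move=> x0; apply: nnval_inj; rewrite x0 nnval0. Qed.

Let nn_cnormD x y : nnval (x + y) <= nnval x + nnval y.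
Proof. by rewrite nnvalD. Qed.

Let nn_cnorm_leD x y : nnval x <= nnval (x + y).
Proof. by rewrite nnvalD lerDl nnval_ge0. Qed.

HB.instance Definition _ := Precone_isCone.Build R nn
  nn_cnormZ nn_cnorm0_eq0  nn_cnormD nn_cnorm_leD
  nn_ball_lub.

End nnreal_cone.

(** ** Measurable and integrable cones *)

(* A small full subcategory of the category of measurable spaces; the last
   field is closure under binary products, up to isomorphism. *)
Record arities := Arities {
  ar_obj :> Type;
  ar_disp : ar_obj -> measure_display;
  ar_space : forall X : ar_obj, measurableType (ar_disp X);
  ar_nonempty : forall X, [set: ar_space X] !=set0;
  ar_one : ar_obj;
  ar_pt : ar_space ar_one;
  ar_ptP : forall r : ar_space ar_one, r = ar_pt;
  ar_prod : forall X Y : ar_obj, exists (Z : ar_obj)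
    (f : ar_space Z -> ar_space X * ar_space Y)
    (g : ar_space X * ar_space Y -> ar_space Z),
    [/\ cancel f g, cancel g f, measurable_fun setT f & measurable_fun setT g]
}.

Coercion ar_space : ar_obj >-> Measurable.type.
Arguments ar_one {a}.
Arguments ar_pt {a}.

HB.mixin Record Cone_isMeasurable (R : realType) (A : arities) P
    of Cone R P := {
  ctest : forall X : A, set (X -> P -> (nnreal R)^o);
  ctest_dual : forall (X : A) m, ctest X m ->
    forall r, clinear (m r) /\ ccontinuous (m r);
  ctest_measurable : forall (X : A) m (x : P), ctest X m -> cnorm x <= 1 ->
    measurable_fun [set: X] (fun r => nnval (m r x)) /\
    (forall r, nnval (m r x) <= 1);
  ctest_comp : forall (X Y : A) (phi : Y -> X) m, measurable_fun setT phi ->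
    ctest X m -> ctest Y (fun s => m (phi s));
  ctest_sep : forall x y : P,
    (forall m, ctest ar_one m -> m ar_pt x = m ar_pt y) -> x = y;
  ctest_norm : forall x : P,
    cnorm x = sup [set nnval (m ar_pt x) / copnorm (m ar_pt) | m in
                    [set m | ctest ar_one m /\ m <> (fun _ _ => 0)]]
}.

#[short(type="mconeType")]
HB.structure Definition MCone (R : realType) (A : arities) :=
  {P of Cone_isMeasurable R A P & Cone R P}.

Arguments ctest {R A} s X.

Definition is_cpath (R : realType) (A : arities) (X : A) (C : mconeType R A)
    (g : X -> C) :=
  cbounded g /\
  (forall (Y : A) m, ctest C Y m ->
    measurable_fun [set: Y * X] (fun p => nnval (m p.1 (g p.2)))).

Definition is_cintegral (R : realType) (A : arities) (X : A)
    (C : mconeType R A) (mu : {finite_measure set X -> \bar R}) (g : X -> C)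
    (x : C) :=
  forall m, ctest C ar_one m ->
    ((nnval (m ar_pt x))%:E = \int[mu]_r (nnval (m ar_pt (g r)))%:E)%E.

HB.mixin Record MCone_isIntegrable (R : realType) (A : arities) P
    of MCone R A P := {
  cintegral_ex : forall (X : A) (mu : {finite_measure set X -> \bar R})
    (g : X -> P), is_cpath g -> exists x : P, is_cintegral mu g x
}.

#[short(type="iconeType")]
HB.structure Definition ICone (R : realType) (A : arities) :=
  {P of MCone_isIntegrable R A P & MCone R A P}.

Section mcone_theory.
Variables (R : realType) (A : arities).

Lemma nn_cincrE (u : nat -> (nnreal R)^o) : cincr u ->
  nondecreasing_seq (fun n => nnval (u n)).
Proof. by move=> iu m n mn; apply/nn_cleE; exact: cincr_le. Qed.

Lemma nn_club_cvg (u : nat -> (nnreal R)^o) l : cincr u -> is_club u l ->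
  (fun n => nnval (u n)) @ \oo --> nnval l.
Proof.
move=> iu [ul lm].
have ubl n : nnval (u n) <= nnval l by exact/nn_cleE.
suff <- : sup (range (fun n => nnval (u n))) = nnval l.
  apply: nondecreasing_cvgn; first exact: nn_cincrE.
  by exists (nnval l) => _ [n _ <-].
have rn : range (fun n => nnval (u n)) !=set0 by exists (nnval (u 0%N)), 0%N.
have hs : has_sup (range (fun n => nnval (u n))).
  by split => //; exists (nnval l) => _ [n _ <-].
apply/eqP; rewrite eq_le; apply/andP; split.
  by apply: ge_sup => // _ [n _ <-].
have uS n : nnval (u n) <= sup (range (fun n => nnval (u n))).
  by apply: sup_upper_bound => //; exists n.
have S0 : 0 <= sup (range (fun n => nnval (u n))).
  by apply: le_trans (uS 0%N); exact: nnval_ge0.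
have lS : cle l (nnreal_of S0 : (nnreal R)^o) by apply: lm => n; apply/nn_cleE.
by move/nn_cleE : lS.
Qed.

Lemma clinear0 (P Q : coneType R) (f : P -> Q) : clinear f -> f 0 = 0.
Proof. by move=> [fZ _]; rewrite -(scale0r (0 : P)) fZ scale0r. Qed.

Lemma clinear_mono (P Q : coneType R) (f : P -> Q) : clinear f ->
  forall x y, cle x y -> cle (f x) (f y).
Proof. by move=> [_ fD] x y [z ->]; rewrite fD; exact: cle_addr. Qed.

Section one.
Variable C : mconeType R A.
Implicit Types (x y : C) (X Y : A).

Lemma ctest_le X m r x : ctest C X m -> nnval (m r x) <= cnorm x.
Proof.
move=> tm; have [ml _] := ctest_dual _ _ tm r.
have [->|x0] := eqVneq x 0; first by rewrite (clinear0 ml) cnorm0 nnval0.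
have [a [b [aE bE ba ab n1]]] := cnorm_inv x0.
have -> : x = a *: (b *: x) by rewrite scalerA ab scale1r.
rewrite ml.1 cnormZ n1 mulr1 (nnvalM a) ler_piMr ?nnval_ge0//.
have nb : cnorm (b *: x) <= 1 by rewrite n1.
exact: (ctest_measurable _ _ _ tm nb).2.
Qed.

Lemma ctest_mf X m x : ctest C X m ->
  measurable_fun [set: X] (fun r => nnval (m r x)).
Proof.
move=> tm; have [->|x0] := eqVneq x 0.
  apply: eq_measurable_fun (measurable_cst (0 : R)) => r _ /=.
  by have [ml _] := ctest_dual _ _ tm r; rewrite (clinear0 ml).
have [a [b [aE bE ba ab n1]]] := cnorm_inv x0.
have nb : cnorm (b *: x) <= 1 by rewrite n1.
have mb := (ctest_measurable _ _ _ tm nb).1.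
have ma := @measurable_cst _ _ X R setT (nnval a).
apply: eq_measurable_fun (measurable_funM ma mb) => r _ /=.
have [ml _] := ctest_dual _ _ tm r.
by rewrite -(nnvalM a) -[a * _]/(a *: m r (b *: x)) -ml.1 scalerA ab scale1r.
Qed.

Lemma ctest_pt X m r : ctest C X m -> ctest C ar_one (fun _ => m r).
Proof. by move=> tm; apply: (ctest_comp _ _ (fun _ : ar_one => r)) tm. Qed.

Lemma ctest_has_sup m : ctest C ar_one m ->
  has_sup [set cnorm (m ar_pt x) | x in @cball R C].
Proof.
move=> tm; split; first by exists (cnorm (m ar_pt 0)), 0; rewrite /cball/= ?cnorm0.
by exists 1 => _ [x x1 <-]; apply: le_trans (ctest_le _ _ tm) x1.
Qed.

Lemma ctest_copnorm_ge0 m : ctest C ar_one m -> 0 <= copnorm (m ar_pt).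
Proof.
move=> tm; apply: le_trans (sup_upper_bound (ctest_has_sup tm) _).
  exact: (cnorm_ge0 (m ar_pt 0)).
by exists 0; rewrite /cball/= ?cnorm0.
Qed.

Lemma ctest_copnorm m x : ctest C ar_one m ->
  nnval (m ar_pt x) <= copnorm (m ar_pt) * cnorm x.
Proof.
move=> tm; have [ml _] := ctest_dual _ _ tm ar_pt.
have [->|x0] := eqVneq x 0.
  by rewrite (clinear0 ml) cnorm0 nnval0 mulr0.
have [a [b [aE bE ba ab n1]]] := cnorm_inv x0.
have {1}-> : x = a *: (b *: x) by rewrite scalerA ab scale1r.
rewrite ml.1 (nnvalM a) aE mulrC ler_wpM2r ?cnorm_ge0//.
apply: (sup_upper_bound (ctest_has_sup tm)).
by exists (b *: x) => //; rewrite /cball/= n1.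
Qed.

Lemma ctest_copnorm_gt0 m : ctest C ar_one m -> m <> (fun _ _ => 0) ->
  0 < copnorm (m ar_pt).
Proof.
move=> tm m0; rewrite lt_neqAle ctest_copnorm_ge0// andbT.
apply: contra_notN m0 => /eqP m0.
apply/funext => r; apply/funext => x; rewrite (ar_ptP r).
apply: nnval_inj; apply/eqP; rewrite nnval0 eq_le nnval_ge0 andbT.
by apply: le_trans (ctest_copnorm x tm) _; rewrite -m0 mul0r.
Qed.

Lemma cnorm_le_ctest x k : 0 <= k -> (forall m, ctest C ar_one m ->
  nnval (m ar_pt x) <= k * copnorm (m ar_pt)) -> cnorm x <= k.
Proof.
move=> k0 xk; rewrite ctest_norm; set S := [set _ | _ in _].
have [->|/set0P S0] := eqVneq S set0; first by rewrite sup0.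
apply: ge_sup => // _ [m [tm m0] <-].
by rewrite ler_pdivrMr ?xk//; exact: ctest_copnorm_gt0.
Qed.

Lemma cpath_mf X (g : X -> C) m : is_cpath g -> ctest C ar_one m ->
  measurable_fun [set: X] (fun r => nnval (m ar_pt (g r))).
Proof.
move=> [_ gm] tm; 
exact: (measurableT_comp (gm _ _ tm) (@pair1_measurable _ _ _ _ ar_pt)).
Qed.

Lemma cpath_emf X (g : X -> C) m : is_cpath g -> ctest C ar_one m ->
  measurable_fun [set: X] (fun r => (nnval (m ar_pt (g r)))%:E).
Proof. by move=> pg tm; apply/measurable_EFinP; exact: cpath_mf. Qed.

Lemma cpath_cst X x : is_cpath (fun _ : X => x).
Proof.
split; first by exists (cnorm x).
by move=> Y m tm; apply: (measurableT_comp (ctest_mf x tm)).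
Qed.

Lemma cpath_comp X Y (g : X -> C) (phi : Y -> X) :
  measurable_fun setT phi -> is_cpath g -> is_cpath (g \o phi).
Proof.
move=> mphi [[M gM] gm]; split; first by exists M => s; exact: gM.
move=> Z m tm; have h := gm _ _ tm.
apply: (measurableT_comp h (g := fun p : Z * Y => (p.1, phi p.2))).
apply/measurable_fun_pair => //=; exact: measurableT_comp.
Qed.

Lemma cpathD X (g h : X -> C) : is_cpath g -> is_cpath h ->
  is_cpath (fun r => g r + h r).
Proof.
move=> [[M gM] gm] [[N hN] hm]; split.
  by exists (M + N) => r; apply: le_trans (cnormD _ _) (lerD _ _).
move=> Z m tm; apply: eq_measurable_fun (measurable_funD (gm _ _ tm) (hm _ _ tm)).
move=> p _ /=; have [ml _] := ctest_dual _ _ tm p.1.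
by rewrite -(nnvalD (m p.1 (g p.2))) ml.2.
Qed.

Lemma cpathZ X a (g : X -> C) : is_cpath g -> is_cpath (fun r => a *: g r).
Proof.
move=> [[M gM] gm]; split.
  by exists (nnval a * M) => r; rewrite cnormZ ler_wpM2l ?nnval_ge0.
move=> Z m tm.
have ma := @measurable_cst _ _ (Z * X)%type R setT (nnval a).
apply: eq_measurable_fun (measurable_funM ma (gm _ _ tm)).
move=> p _ /=; have [ml _] := ctest_dual _ _ tm p.1.
by rewrite ml.1 (nnvalM a).
Qed.

Lemma cpath_club X (g : nat -> X -> C) (h : X -> C) M :
  (forall n, is_cpath (g n)) -> (forall r, cincr (g^~ r)) ->
  (forall n r, cnorm (g n r) <= M) ->
  (forall r, is_club (g^~ r) (h r)) -> is_cpath h.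
Proof.
move=> pg ig gM gh; split.
  by exists M => r; apply: cbound_lub_le (gh r).
move=> Z m tm.
apply: (@measurable_fun_cvg _ _ _ _
  (fun n (p : Z * X) => nnval (m p.1 (g n p.2)))) => [n|p _].
  exact: (pg n).2.
have [ml mc] := ctest_dual _ _ tm p.1.
apply: (@nn_club_cvg (fun n => m p.1 (g n p.2))).
  by move=> n; apply: mc.1; exact: ig.
by apply: mc.2 (gh _) => //; exists M => n.
Qed.

Lemma cintegral_uniq X (mu : {finite_measure set X -> \bar R}) (g : X -> C) x y :
  is_cintegral mu g x -> is_cintegral mu g y -> x = y.
Proof.
move=> gx gy; apply: ctest_sep => m tm; apply: nnval_inj.
by apply: EFin_inj; rewrite gx// gy.
Qed.

Lemma cintegralD X (mu : {finite_measure set X -> \bar R}) (g h : X -> C) x y :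
  is_cpath g -> is_cpath h -> is_cintegral mu g x -> is_cintegral mu h y ->
  is_cintegral mu (fun r => g r + h r) (x + y).
Proof.
move=> pg ph gx hy m tm; have [ml _] := ctest_dual _ _ tm ar_pt.
rewrite ml.2 nnvalD EFinD (gx m)// (hy m)// -ge0_integralD//=; last 4 first.
- by move=> r _; rewrite lee_fin nnval_ge0.
- exact: cpath_emf.
- by move=> r _; rewrite lee_fin nnval_ge0.
- exact: cpath_emf.
by apply: eq_integral => r _; rewrite ml.2 nnvalD.
Qed.

Lemma cintegralZ X (mu : {finite_measure set X -> \bar R}) a (g : X -> C) x :
  is_cpath g -> is_cintegral mu g x ->
  is_cintegral mu (fun r => a *: g r) (a *: x).
Proof.
move=> pg gx m tm; have [ml _] := ctest_dual _ _ tm ar_pt.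
rewrite ml.1 (nnvalM a) EFinM (gx m)// -ge0_integralZl//=; last 3 first.
- exact: cpath_emf.
- by move=> r _; rewrite lee_fin nnval_ge0.
- by rewrite lee_fin nnval_ge0.
by apply: eq_integral => r _; rewrite ml.1 (nnvalM a).
Qed.

Lemma cintegral_club X (mu : {finite_measure set X -> \bar R})
    (g : nat -> X -> C) (h : X -> C) (u : nat -> C) x M :
  (forall n, is_cpath (g n)) -> (forall r, cincr (g^~ r)) ->
  (forall n r, cnorm (g n r) <= M) ->
  (forall r, is_club (g^~ r) (h r)) ->
  cincr u -> cbounded u -> is_club u x ->
  (forall n, is_cintegral mu (g n) (u n)) -> is_cintegral mu h x.
Proof.
move=> pg ig gM gh iu bu ux gu m tm; have [ml mc] := ctest_dual _ _ tm ar_pt.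
have c1 : (fun n => (nnval (m ar_pt (u n)))%:E) @ \oo --> (nnval (m ar_pt x))%:E.
  apply: cvg_EFin; first exact: nearW.
  apply: (@nn_club_cvg (fun n => m ar_pt (u n))) => [n|].
    by apply: mc.1; exact: iu.
  exact: mc.2.
have c2 r : (fun n => (nnval (m ar_pt (g n r)))%:E) @ \oo -->
    (nnval (m ar_pt (h r)))%:E.
  apply: cvg_EFin; first exact: nearW.
  apply: (@nn_club_cvg (fun n => m ar_pt (g n r))) => [n|].
    by apply: mc.1; exact: ig.
  by apply: mc.2 => //; exists M => n.
have e1 : limn (fun n => (nnval (m ar_pt (u n)))%:E) = (nnval (m ar_pt x))%:E.
  exact/cvg_lim.
rewrite -e1.
transitivity (\int[mu]_r limn (fun n => (nnval (m ar_pt (g n r)))%:E))%E; last first.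
  by apply: eq_integral => r _; apply/cvg_lim.
rewrite monotone_convergence//.
- by congr (limn _); apply/funext => n; exact: gu.
- by move=> n; exact: cpath_emf.
- by move=> n r _; rewrite lee_fin nnval_ge0.
- move=> r _ i j ij; rewrite lee_fin; apply/nn_cleE; apply: mc.1.
  exact: (cincr_le (ig r)).
Qed.

Lemma cintegral_norm X (mu : {finite_measure set X -> \bar R}) (g : X -> C) x M :
  0 <= M -> is_cpath g -> is_cintegral mu g x -> (forall r, cnorm (g r) <= M) ->
  cnorm x <= M * fine (mu setT).
Proof.
move=> M0 pg gx gM; have mufin : mu setT \is a fin_num by exact: fin_num_measure.
apply: cnorm_le_ctest => [|m tm]; first by rewrite mulr_ge0// fine_ge0.
have op0 := ctest_copnorm_ge0 tm.
rewrite -lee_fin gx// mulrAC EFinM fineK//.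
rewrite -(integral_cst mu measurableT).
apply: ge0_le_integral => //=.
- by move=> r _; rewrite lee_fin nnval_ge0.
- exact: cpath_emf.
- move=> r _; rewrite lee_fin; apply: le_trans (ctest_copnorm _ tm) _.
  by rewrite mulrC ler_wpM2r.
Qed.

End one.
End mcone_theory.

(** ** The category of integrable cones *)

Section icones.
Variables (R : realType) (A : arities).
Implicit Types B C D : iconeType R A.

(* The third clause is [||f|| <= 1]; it does not use [copnorm] because [sup] in
   [R] is [0] on unbounded sets. *)
Definition is_icones C D (f : C -> D) :=
  [/\ clinear f,
      ccontinuous f,
      (forall x, cnorm x <= 1 -> cnorm (f x) <= 1),
      (forall (X : A) (g : X -> C), is_cpath g -> is_cpath (f \o g)) &
      (forall (X : A) (mu : {finite_measure set X -> \bar R}) (g : X -> C) x,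
        is_cpath g -> is_cintegral mu g x -> is_cintegral mu (f \o g) (f x))].

Record ichom C D := ICHom {
  ichom_fun :> C -> D;
  ichomP : is_icones ichom_fun }.

Record lhom C D := LHom {
  lhom_fun :> C -> D;
  lhomP : exists2 eps : nnreal R, 0 < nnval eps &
            is_icones (fun x => eps *: lhom_fun x) }.

Lemma ichom_ext C D (f g : ichom C D) : f =1 g -> f = g.
Proof.
case: f g => [f fP] [g gP] /= /funext fg; subst g.
by congr ICHom; exact: Prop_irrelevance.
Qed.

Lemma lhom_ext C D (f g : lhom C D) : f =1 g -> f = g.
Proof.
case: f g => [f fP] [g gP] /= /funext fg; subst g.
by congr LHom; exact: Prop_irrelevance.
Qed.

Lemma is_icones_id C : is_icones (@id C).
Proof. by split => //; split. Qed.

Definition ichom_id C : ichom C C := ICHom (is_icones_id C).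

Lemma ccontinuous_incr C D (f : C -> D) u : clinear f -> cincr u ->
  cincr (f \o u).
Proof. by move=> fl iu n; apply: (clinear_mono fl); exact: iu. Qed.

Lemma is_icones_comp B C D (g : C -> D) (f : B -> C) :
  is_icones g -> is_icones f -> is_icones (g \o f).
Proof.
move=> [gl gc gn gp gi] [fl fc fn fp fi]; split.
- by split=> [a x|x y] /=; [rewrite fl.1 gl.1|rewrite fl.2 gl.2].
- split=> [x y xy|u l iu [M uM] ul] /=; first by apply: gc.1; exact: fc.1.
  apply: (gc.2 (f \o u)); [exact: ccontinuous_incr| |].
    exists (cnorm (f l)) => n /=.
    by apply: cle_cnorm; apply: fc.1; exact: ul.1.
  by apply: fc.2 => //; exists M.
- by move=> x x1 /=; apply: gn; exact: fn.
- by move=> X h ph; apply: (gp _ (f \o h)); exact: fp.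
- move=> X mu h x ph hx; apply: (gi _ mu (f \o h)); [exact: fp|exact: fi].
Qed.

Definition ichom_comp B C D (g : ichom C D) (f : ichom B C) : ichom B D :=
  ICHom (is_icones_comp (ichomP g) (ichomP f)).

(* Bounded homomorphisms, shown below to be the elements of [lhom C D]. *)
Definition is_bhom C D (f : C -> D) :=
  [/\ clinear f,
      ccontinuous f,
      (exists2 M : R, 0 <= M & forall x, cnorm (f x) <= M * cnorm x),
      (forall (X : A) (g : X -> C), is_cpath g -> is_cpath (f \o g)) &
      (forall (X : A) (mu : {finite_measure set X -> \bar R}) (g : X -> C) x,
        is_cpath g -> is_cintegral mu g x -> is_cintegral mu (f \o g) (f x))].

Lemma clinear_norm C D (f : C -> D) M : clinear f -> 0 <= M ->
  (forall x, cnorm x <= 1 -> cnorm (f x) <= M) ->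
  forall x, cnorm (f x) <= M * cnorm x.
Proof.
move=> fl M0 fM x; have [->|x0] := eqVneq x 0.
  by rewrite (clinear0 fl) !cnorm0 mulr0.
have [a [b [aE bE ba ab n1]]] := cnorm_inv x0.
have {1}-> : x = a *: (b *: x) by rewrite scalerA ab scale1r.
rewrite fl.1 cnormZ aE mulrC ler_wpM2r ?cnorm_ge0//.
by apply: fM; rewrite n1.
Qed.

Lemma icones_bhom C D (f : C -> D) : is_icones f -> is_bhom f.
Proof.
move=> [fl fc fn fp fi]; split => //.
by exists 1 => //; apply: clinear_norm.
Qed.

Lemma bhom_icones C D (f : C -> D) : is_bhom f ->
  (forall x, cnorm (f x) <= cnorm x) -> is_icones f.
Proof.
by move=> [fl fc _ fp fi] f1; split => // x; apply: le_trans (f1 _).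
Qed.

Lemma bhomZ C D (a : nnreal R) (f : C -> D) :
  is_bhom f -> is_bhom (fun x => a *: f x).
Proof.
move=> [fl fc [M M0 fM] fp fi]; split.
- split=> [b x|x y]; last by rewrite fl.2 scalerDr.
  by rewrite fl.1 !scalerA mulrC.
- split=> [x y xy|u l iu bu ul]; first by apply: cleZ; exact: fc.1.
  by apply: (clubZ a); exact: fc.2.
- exists (nnval a * M) => [|x]; first by rewrite mulr_ge0 ?nnval_ge0.
  by rewrite cnormZ -mulrA ler_wpM2l ?nnval_ge0.
- by move=> X g pg; apply: (cpathZ a (fp _ _ pg)).
- by move=> X mu g x pg gx; apply: (cintegralZ a (fp _ _ pg)); exact: fi.
Qed.

Lemma bhomD C D (f g : C -> D) :
  is_bhom f -> is_bhom g -> is_bhom (fun x => f x + g x).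
Proof.
move=> [fl fc [M M0 fM] fp fi] [gl gc [N N0 gN] gp gi]; split.
- split=> [b x|x y]; first by rewrite fl.1 gl.1 scalerDr.
  by rewrite fl.2 gl.2 addrACA.
- split=> [x y xy|u l iu bu ul]; first by apply: cleD; [exact: fc.1|exact: gc.1].
  apply: (@clubD _ _ (f \o u) (g \o u)); [| |exact: fc.2|exact: gc.2];
    exact: ccontinuous_incr.
- exists (M + N) => [|x]; first by rewrite addr_ge0.
  by rewrite mulrDl (le_trans (cnormD _ _))// lerD.
- by move=> X h ph; apply: (cpathD (fp _ _ ph) (gp _ _ ph)).
- move=> X mu h x ph hx; apply: (cintegralD (fp _ _ ph) (gp _ _ ph)).
    exact: fi.
  exact: gi.
Qed.

Lemma bhom0 C D : is_bhom (fun _ : C => 0 : D).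
Proof.
split.
- by split=> [a x|x y]; rewrite ?scaler0 ?addr0.
- split=> [x y _|u l _ _ _]; first exact: cle_refl.
  by split=> [n|y _]; [exact: cle_refl|exists y; rewrite add0r].
- by exists 0 => // x; rewrite cnorm0 mul0r.
- by move=> X g _; exact: cpath_cst.
- move=> X mu g x _ _ m tm; have [ml _] := ctest_dual _ _ tm ar_pt.
  rewrite (clinear0 ml) nnval0 -[LHS](integral0 mu [set: X]).
  by apply: eq_integral => r _; rewrite -[LHS]/(0%:E) -(nnval0 R) -(clinear0 ml).
Qed.

Lemma lhom_bhom C D (f : lhom C D) : is_bhom f.
Proof.
have [eps e0 /icones_bhom he] := lhomP f.
have [a [b [aE bE ba ab]]] := nnreal_inv e0.
have ae : a = eps by exact: nnval_inj.
have := bhomZ b he; congr is_bhom; apply/funext => x.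
by rewrite scalerA -ae ba scale1r.
Qed.

Lemma bhom_lhom C D (f : C -> D) : is_bhom f ->
  exists2 eps : nnreal R, 0 < nnval eps & is_icones (fun x => eps *: f x).
Proof.
move=> hf; have [_ _ [M M0 fM] _ _] := hf.
have M1 : 0 < M + 1 by rewrite ltr_wpDl.
have [a [b [aE bE ba ab]]] := nnreal_inv M1.
exists b; first by rewrite bE invr_gt0.
apply: bhom_icones (bhomZ b hf) _ => x.
rewrite cnormZ bE ler_pdivrMl// (le_trans (fM x))//.
by rewrite ler_wpM2r ?cnorm_ge0// lerDl.
Qed.

Definition mk_lhom C D (f : C -> D) (hf : is_bhom f) : lhom C D :=
  LHom (bhom_lhom hf).

Lemma ccontinuous_club C D (f : C -> D) u l : is_bhom f -> cincr u ->
  is_club u l -> is_club (f \o u) (f l).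
Proof.
move=> [_ fc _ _ _] iu ul; apply: fc.2 => //.
by exists (cnorm l) => n; apply: cle_cnorm; exact: ul.1.
Qed.

(* The difference of two bounded homomorphisms, when it exists pointwise. *)
Lemma bhomB C D (f g h : C -> D) : is_bhom f -> is_bhom g ->
  (forall x, g x = f x + h x) -> is_bhom h.
Proof.
move=> hf hg gE.
have [fl fc _ fp fi] := hf; have [gl gc [N N0 gN] gp gi] := hg.
have hl : clinear h.
  split=> [a x|x y].
    apply: (@addcI _ _ (f (a *: x))).
    by rewrite addrC -gE fl.1 gl.1 gE scalerDr addrC.
  apply: (@addcI _ _ (f (x + y))).
  by rewrite addrC -gE fl.2 gl.2 !gE addrACA addrC.
have hN x : cnorm (h x) <= N * cnorm x.
  by apply: le_trans (gN x); apply: cle_cnorm; rewrite gE addrC; exact: cle_addr.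
have hp : forall (X : A) (k : X -> C), is_cpath k -> is_cpath (h \o k).
  move=> X k pk; split.
    by have [[M kM] _] := pk; exists (N * M) => r; rewrite (le_trans (hN _))// ler_wpM2l.
  move=> Y m tm.
  have mB := measurable_funB ((gp _ _ pk).2 _ _ tm) ((fp _ _ pk).2 _ _ tm).
  apply: eq_measurable_fun mB => p _ /=.
  have [ml _] := ctest_dual _ _ tm p.1.
  by rewrite gE ml.2 nnvalD addrC addKr.
split => //.
- split=> [|u l iu bu ul]; first exact: clinear_mono.
  split=> [n|y hy]; first by apply: (clinear_mono hl); exact: ul.1.
  apply: (@cle_addI _ _ (f l)); rewrite -gE.
  apply: (ccontinuous_club hg iu ul).2 => n /=; rewrite gE.
  by apply: cleD (hy n); apply: (clinear_mono fl); exact: ul.1.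
- by exists N.
- move=> X mu k x pk kx m tm; have [ml _] := ctest_dual _ _ tm ar_pt.
  have fx := fi _ mu _ _ pk kx m tm; have gx := gi _ mu _ _ pk kx m tm.
  move: gx; rewrite gE ml.2 nnvalD EFinD.
  have -> : (\int[mu]_r (nnval (m ar_pt ((g \o k) r)))%:E)%E =
     (\int[mu]_r (nnval (m ar_pt ((f \o k) r)))%:E +
      \int[mu]_r (nnval (m ar_pt ((h \o k) r)))%:E)%E.
    rewrite -ge0_integralD//=; last 4 first.
    - by move=> r _; rewrite lee_fin nnval_ge0.
    - exact: (cpath_emf (fp _ _ pk)).
    - by move=> r _; rewrite lee_fin nnval_ge0.
    - exact: (cpath_emf (hp _ _ pk)).
    by apply: eq_integral => r _; rewrite gE ml.2 nnvalD EFinD.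
  rewrite -fx => /(congr1 (fun z => z - (nnval (m ar_pt (f x)))%:E)%E).
  by rewrite ![((nnval (m ar_pt (f x)))%:E + _)%E]addeC !addeK.
Qed.

(* Pointwise least upper bounds of bounded homomorphisms. *)
Lemma bhom_club C D (u : nat -> C -> D) (f : C -> D) (M : R) : 0 <= M ->
  (forall n, is_bhom (u n)) -> (forall x, cincr (u^~ x)) ->
  (forall n x, cnorm (u n x) <= M * cnorm x) ->
  (forall x, is_club (u^~ x) (f x)) -> is_bhom f.
Proof.
move=> M0 hu iu uM uf.
have ul n : clinear (u n) by case: (hu n).
have fl : clinear f.
  split=> [a x|x y].
    apply: (club_uniq (uf _)).
    rewrite (_ : u^~ (a *: x) = fun n => a *: u n x); first exact: clubZ.
    by apply/funext => n; rewrite (ul n).1.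
  apply: (club_uniq (uf _)).
  rewrite (_ : u^~ (x + y) = fun n => u n x + u n y); first exact: clubD.
  by apply/funext => n; rewrite (ul n).2.
have fM x : cnorm (f x) <= M * cnorm x by apply: cbound_lub_le (uf x).
have pathM (X : A) (g : X -> C) : is_cpath g ->
    exists N, forall n r, cnorm (u n (g r)) <= N.
  move=> [[N gN] _]; exists (M * N) => n r.
  by rewrite (le_trans (uM _ _))// ler_wpM2l.
have fp (X : A) (g : X -> C) : is_cpath g -> is_cpath (f \o g).
  move=> pg; have [N gN] := pathM _ _ pg.
  apply: (@cpath_club _ _ _ _ (fun n r => u n (g r)) _ N) => // n.
  by have [_ _ _ up _] := hu n; exact: (up _ _ pg).
split => //.
- split=> [|v l iv bv vl]; first exact: clinear_mono.
  split=> [n|y fy]; first by apply: (clinear_mono fl); exact: vl.1.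
  apply: (uf l).2 => n; apply: (ccontinuous_club (hu n) iv vl).2 => k /=.
  exact: cle_trans ((uf _).1 n) (fy k).
- by exists M.
- move=> X mu g x pg gx; have [N gN] := pathM _ _ pg.
  apply: (@cintegral_club _ _ _ _ mu (fun n r => u n (g r)) _ (u^~ x) _ N) => //.
  - by move=> n; have [_ _ _ up _] := hu n; exact: (up _ _ pg).
  - by exists (M * cnorm x).
  - by move=> n; have [_ _ _ _ ui] := hu n; exact: (ui _ mu _ _ pg).
Qed.

End icones.

(** ** The integrable cone of linear maps *)

Section lhom_cone.
Variables (R : realType) (A : arities) (C D : iconeType R A).
Local Notation H := (lhom C D).
Implicit Types (f g h : H) (x y : C).

HB.instance Definition _ := gen_eqMixin H.
HB.instance Definition _ := gen_choiceMixin H.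

Definition lhom_zero : H := mk_lhom (@bhom0 R A C D).
Definition lhom_add f g : H := mk_lhom (bhomD (lhom_bhom f) (lhom_bhom g)).
Definition lhom_scale (a : nnreal R) f : H := mk_lhom (bhomZ a (lhom_bhom f)).

Let lhom_addA : associative lhom_add.
Proof. by move=> f g h; apply: lhom_ext => x; exact: addrA. Qed.

Let lhom_addC : commutative lhom_add.
Proof. by move=> f g; apply: lhom_ext => x; exact: addrC. Qed.

Let lhom_add0 : left_id lhom_zero lhom_add.
Proof. by move=> f; apply: lhom_ext => x; exact: add0r. Qed.

HB.instance Definition _ :=
  GRing.isNmodule.Build H lhom_addA lhom_addC lhom_add0.

Let lhom_scaleA a b f : lhom_scale a (lhom_scale b f) = lhom_scale (a * b) f.
Proof. by apply: lhom_ext => x; exact: scalerA. Qed.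

Let lhom_scale0 f : lhom_scale 0 f = 0.
Proof. by apply: lhom_ext => x; exact: scale0r. Qed.

Let lhom_scale1 : left_id 1 lhom_scale.
Proof. by move=> f; apply: lhom_ext => x; exact: scale1r. Qed.

Let lhom_scaleDr : right_distributive lhom_scale +%R.
Proof. by move=> a f g; apply: lhom_ext => x; exact: scalerDr. Qed.

Let lhom_scaleDl f : {morph lhom_scale^~ f : a b / a + b}.
Proof. by move=> a b; apply: lhom_ext => x; exact: scalerDl. Qed.

HB.instance Definition _ := GRing.Nmodule_isLSemiModule.Build (nnreal R) H
  lhom_scaleA lhom_scale0 lhom_scale1 lhom_scaleDr lhom_scaleDl.

Let lhom_addcI f g h : g + f = h + f -> g = h.
Proof.
move=> e; apply: lhom_ext => x; apply: (@addcI _ _ (f x)).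
exact: (congr1 (fun k : H => k x) e).
Qed.

Let lhom_addc_eq0l f g : f + g = 0 -> f = 0.
Proof.
move=> e; apply: lhom_ext => x; apply: (@addc_eq0l _ _ _ (g x)).
exact: (congr1 (fun k : H => k x) e).
Qed.

HB.instance Definition _ :=
  LSemiModule_isPrecone.Build R H lhom_addcI lhom_addc_eq0l.

Lemma lhom_cle f g : (forall x, cle (f x) (g x)) -> cle f g.
Proof.
move=> fg; have [h hE] := choice fg.
exists (mk_lhom (bhomB (lhom_bhom f) (lhom_bhom g) hE)).
by apply: lhom_ext => x; exact: hE.
Qed.

Lemma cle_lhom f g x : cle f g -> cle (f x) (g x).
Proof. by move=> [h ->]; exists (h x). Qed.

Lemma lhom_has_sup f : has_sup [set cnorm (f x) | x in @cball R C].
Proof.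
have [_ _ [M M0 fM] _ _] := lhom_bhom f; split.
  by exists (cnorm (f 0)), 0; rewrite /cball/= ?cnorm0.
by exists M => _ [x x1 <-]; rewrite (le_trans (fM x))// ler_piMr.
Qed.

Definition lhom_norm f : R := copnorm f.

Lemma lnorm_lub f M : (forall x, cnorm x <= 1 -> cnorm (f x) <= M) ->
  lhom_norm f <= M.
Proof.
move=> fM; apply: ge_sup => [|_ [x x1 <-]]; last exact: fM.
by case: (lhom_has_sup f).
Qed.

Lemma lnorm_ball f x : cnorm x <= 1 -> cnorm (f x) <= lhom_norm f.
Proof. by move=> x1; apply: (sup_upper_bound (lhom_has_sup f)); exists x. Qed.

Lemma lnorm_ge0 f : 0 <= lhom_norm f.
Proof. by apply: le_trans (@lnorm_ball f 0 _); rewrite ?cnorm_ge0 ?cnorm0. Qed.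

Lemma lnorm_le f x : cnorm (f x) <= lhom_norm f * cnorm x.
Proof.
apply: clinear_norm => [| |y]; [by case: (lhom_bhom f)|exact: lnorm_ge0|].
exact: lnorm_ball.
Qed.

Let lhom_normZ_le (a : nnreal R) f : lhom_norm (a *: f) <= nnval a * lhom_norm f.
Proof.
apply: lnorm_lub => x x1; rewrite [cnorm _](cnormZ a (f x)).
by rewrite ler_wpM2l ?nnval_ge0//; exact: lnorm_ball.
Qed.

Let lhom_normZ (a : nnreal R) f : lhom_norm (a *: f) = nnval a * lhom_norm f.
Proof.
apply/eqP; rewrite eq_le lhom_normZ_le /=.
have [->|a0] := eqVneq (nnval a) 0; first by rewrite mul0r lnorm_ge0.
have ap : 0 < nnval a by rewrite lt_neqAle eq_sym a0 nnval_ge0.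
have [a' [b [aE bE ba ab]]] := nnreal_inv ap.
have {}aE : a' = a by exact: nnval_inj.
have := lhom_normZ_le b (a *: f).
by rewrite scalerA -aE ba scale1r bE aE ler_pdivlMl.
Qed.

Let lhom_norm0_eq0 f : lhom_norm f = 0 -> f = 0.
Proof.
move=> f0; apply: lhom_ext => x; apply: cnorm0_eq0; apply/eqP.
by rewrite eq_le cnorm_ge0 andbT (le_trans (lnorm_le f x))// f0 mul0r.
Qed.

Let lhom_normD f g : lhom_norm (f + g) <= lhom_norm f + lhom_norm g.
Proof.
apply: lnorm_lub => x x1; apply: le_trans (cnormD (f x) (g x)) _.
by apply: lerD; exact: lnorm_ball.
Qed.

Let lhom_norm_leD f g : lhom_norm f <= lhom_norm (f + g).
Proof.
apply: lnorm_lub => x x1; apply: le_trans (@lnorm_ball (f + g) x x1).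
exact: (cnorm_leD (f x) (g x)).
Qed.

Lemma lhom_lub (u : nat -> H) (M : R) : 0 <= M -> cincr u ->
  (forall n, lhom_norm (u n) <= M) ->
  exists f : H, [/\ is_club u f, forall x, is_club (fun n => u n x) (f x) &
    lhom_norm f <= M].
Proof.
move=> M0 iu uM.
have ix x : cincr (fun n => u n x) by move=> n; exact: cle_lhom.
have bx x n : cnorm (u n x) <= M * cnorm x.
  by rewrite (le_trans (lnorm_le _ _))// ler_wpM2r ?cnorm_ge0.
have lx x : exists l, is_club (fun n => u n x) l.
  have [|l ul _] := cbound_lub _ (ix x) (bx x); last by exists l.
  by rewrite mulr_ge0 ?cnorm_ge0.
have [f fE] := choice lx.
have hf : is_bhom f.
  by apply: (bhom_club M0 (u := fun n => u n : C -> D)) => // n; exact: lhom_bhom.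
exists (mk_lhom hf); split => //.
- split=> [n|g ug]; first by apply: lhom_cle => x; exact: (fE x).1.
  by apply: lhom_cle => x; apply: (fE x).2 => n; exact: cle_lhom.
- apply: lnorm_lub => x x1; apply: (cbound_lub_le (ix x)) (fE x) => n.
  by rewrite (le_trans (bx x n))// ler_piMr.
Qed.

Let lhom_ball_lub (u : nat -> H) : cincr u -> (forall n, lhom_norm (u n) <= 1) ->
  exists2 l, is_club u l & lhom_norm l <= 1.
Proof.
by move=> iu u1; have [f [uf _ f1]] := lhom_lub ler01 iu u1; exists f.
Qed.

HB.instance Definition _ := Precone_isCone.Build R H
  lhom_normZ lhom_norm0_eq0 lhom_normD lhom_norm_leD lhom_ball_lub.

Lemma lhom_club (u : nat -> H) f : cincr u -> is_club u f ->
  forall x, is_club (fun n => u n x) (f x).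
Proof.
move=> iu uf x.
have [|g [ug gx _]] := lhom_lub (cnorm_ge0 f) iu.
  by move=> n; apply: (cle_cnorm (x := u n)); exact: uf.1.
by rewrite (club_uniq uf ug).
Qed.

(* The paths are taken in the unit ball, so that the tests take their values in
   [[0, 1]] on the unit ball of [lhom C D]. *)
Definition lhom_test (X : A) : set (X -> H -> (nnreal R)^o) :=
  [set t | exists (g : X -> C) (m : X -> D -> (nnreal R)^o),
    [/\ is_cpath g, (forall r, cnorm (g r) <= 1), ctest D X m &
        t = fun r f => m r (f (g r))]].

Arguments lhom_test : clear implicits.

Let lhom_test_dual (X : A) t : lhom_test X t ->
  forall r, clinear (t r) /\ ccontinuous (t r).
Proof.
move=> [g [m [pg g1 tm ->]]] r; have [ml mc] := ctest_dual _ _ tm r; split.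
  by split=> [a f|f h]; [exact: ml.1|exact: ml.2].
split=> [f h fh|u f iu [M uM] uf]; first by apply: mc.1; exact: cle_lhom.
apply: (mc.2 (fun n => u n (g r))); last exact: lhom_club.
  by move=> n; exact: cle_lhom.
exists M => n; apply: le_trans (uM n); exact: lnorm_ball.
Qed.

Let lhom_test_measurable (X : A) t f : lhom_test X t -> lhom_norm f <= 1 ->
  measurable_fun [set: X] (fun r => nnval (t r f)) /\
  (forall r, nnval (t r f) <= 1).
Proof.
move=> [g [m [pg g1 tm ->]]] f1; split=> [|r].
  have [_ _ _ fp _] := lhom_bhom f.
  have hm := (fp _ _ pg).2 _ _ tm.
  apply: (measurableT_comp hm (g := fun r : X => (r, r))).
  exact: measurable_fun_pair.
apply: le_trans (ctest_le _ _ tm) _.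
by apply: le_trans f1; exact: lnorm_ball.
Qed.

Let lhom_test_comp (X Y : A) (phi : Y -> X) t : measurable_fun setT phi ->
  lhom_test X t -> lhom_test Y (fun s => t (phi s)).
Proof.
move=> mphi [g [m [pg g1 tm ->]]]; exists (g \o phi), (fun s => m (phi s)).
by split => //; [exact: cpath_comp|move=> r; exact: g1|exact: (ctest_comp _ _ phi)].
Qed.

Lemma lhom_test_pt x (m : ar_one -> D -> (nnreal R)^o) : cnorm x <= 1 ->
  ctest D ar_one m ->
  lhom_test ar_one (fun r f => m r (f x)).
Proof. by move=> x1 tm; exists (fun _ => x), m; split => //; exact: cpath_cst. Qed.

Let lhom_test_sep f g :
  (forall t, lhom_test ar_one t -> t ar_pt f = t ar_pt g) -> f = g.
Proof.
move=> fg; apply: lhom_ext => x; have [->|x0] := eqVneq x 0.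
  by rewrite !clinear0//; [case: (lhom_bhom g)|case: (lhom_bhom f)].
have [a [b [aE bE ba ab n1]]] := cnorm_inv x0.
have xE : x = a *: (b *: x) by rewrite scalerA ab scale1r.
rewrite xE; have [[fZ _] _ _ _ _] := lhom_bhom f.
have [[gZ _] _ _ _ _] := lhom_bhom g; rewrite fZ gZ; congr (_ *: _).
have b1 : cnorm (b *: x) <= 1 by rewrite n1.
by apply: ctest_sep => m tm; exact: (fg _ (lhom_test_pt b1 tm)).
Qed.

Lemma lhom_test_le (X : A) t r f : lhom_test X t -> nnval (t r f) <= cnorm f.
Proof.
move=> [g [m [pg g1 tm ->]]]; apply: le_trans (ctest_le _ _ tm) _.
exact: (lnorm_ball f (g1 r)).
Qed.

Let lhom_test_has_sup t : lhom_test ar_one t ->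
  has_sup [set cnorm (t ar_pt f) | f in @cball R H].
Proof.
move=> tt; split.
  by exists (cnorm (t ar_pt 0)), 0; rewrite // /cball/= cnorm0.
by exists 1 => _ [f f1 <-]; apply: le_trans (lhom_test_le _ _ tt) f1.
Qed.

Let lhom_test_copnorm t f : lhom_test ar_one t ->
  nnval (t ar_pt f) <= copnorm (t ar_pt) * cnorm f.
Proof.
move=> tt; have [tl _] := lhom_test_dual tt ar_pt.
have [->|f0] := eqVneq f 0; first by rewrite (clinear0 tl) cnorm0 nnval0 mulr0.
have [a [b [aE bE ba ab n1]]] := cnorm_inv f0.
have {1}-> : f = a *: (b *: f) by rewrite scalerA ab scale1r.
rewrite tl.1 (nnvalM a) aE mulrC ler_wpM2r ?cnorm_ge0//.
apply: (sup_upper_bound (lhom_test_has_sup tt)).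
by exists (b *: f) => //; rewrite /cball/= n1.
Qed.

Let lhom_test_norm f :
  cnorm f = sup [set nnval (t ar_pt f) / copnorm (t ar_pt) | t in
                    [set t | lhom_test ar_one t /\ t <> (fun _ _ => 0)]].
Proof.
set S := [set _ | _ in _].
have copt0 t : lhom_test ar_one t -> 0 <= copnorm (t ar_pt).
  move=> tt; apply: le_trans (sup_upper_bound (lhom_test_has_sup tt) _).
    exact: (cnorm_ge0 (t ar_pt 0)).
  by exists 0; rewrite // /cball/= cnorm0.
have ubS : ubound S (cnorm f).
  move=> _ [t [tt _] <-]; have [->|t0] := eqVneq (copnorm (t ar_pt)) 0.
    by rewrite invr0 mulr0 cnorm_ge0.
  rewrite ler_pdivrMr ?lt_neqAle 1?eq_sym ?t0 ?copt0// mulrC.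
  exact: lhom_test_copnorm.
have S0 : 0 <= sup S.
  have [->|/set0P[s Ss]] := eqVneq S set0; first by rewrite sup0.
  have hS : has_sup S by split; [exists s|exists (cnorm f)].
  apply: le_trans (sup_upper_bound hS Ss).
  by have [t [tt _] <-] := Ss; rewrite divr_ge0 ?nnval_ge0 ?copt0.
apply/eqP; rewrite eq_le; apply/andP; split; last first.
  by have [->|/set0P Sn0] := eqVneq S set0; [rewrite sup0 cnorm_ge0|exact: ge_sup].
apply: lnorm_lub => x x1; apply: cnorm_le_ctest => // m tm.
pose t : ar_one -> H -> (nnreal R)^o := fun r h => m r (h x).
have tt : lhom_test ar_one t by exact: lhom_test_pt.
have [t0|t0] := pselect (t = fun _ _ => 0).
  rewrite -[m ar_pt (f x)]/(t ar_pt f) t0 nnval0 mulr_ge0//.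
  exact: ctest_copnorm_ge0.
have [c0|c0] := eqVneq (copnorm (t ar_pt)) 0.
  apply: le_trans (lhom_test_copnorm f tt) _.
  by rewrite c0 mul0r mulr_ge0// ctest_copnorm_ge0.
have St : S (nnval (t ar_pt f) / copnorm (t ar_pt)) by exists t.
have hS : has_sup S by split; [exists (nnval (t ar_pt f) / copnorm (t ar_pt))|
  exists (cnorm f)].
have := sup_upper_bound hS St.
rewrite ler_pdivrMr ?lt_neqAle 1?eq_sym ?c0 ?copt0// => /le_trans; apply.
rewrite ler_wpM2l//; apply: ge_sup; first by case: (lhom_test_has_sup tt).
move=> _ [h h1 <-]; apply: le_trans (ctest_copnorm _ tm) _.
rewrite ler_piMr ?ctest_copnorm_ge0//.
by apply: le_trans h1; exact: (lnorm_ball h x1).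
Qed.

HB.instance Definition _ := Cone_isMeasurable.Build R A H
  lhom_test_dual lhom_test_measurable lhom_test_comp lhom_test_sep
  lhom_test_norm.

Lemma lhom_cpath_mf (X Y Z : A) (eta : X -> H) (g : Y -> C) m :
  is_cpath eta -> is_cpath g -> ctest D Z m ->
  measurable_fun [set: (Z * Y) * X]
    (fun p => nnval (m p.1.1 (eta p.2 (g p.1.2)))).
Proof.
move=> peta.
have ball (k : Y -> C) : is_cpath k -> (forall r, cnorm (k r) <= 1) ->
    ctest D Z m -> measurable_fun [set: (Z * Y) * X]
      (fun p => nnval (m p.1.1 (eta p.2 (k p.1.2)))).
  move=> pk k1 tm; have [W [i [j [ij ji mi mj]]]] := ar_prod Z Y.
  pose t : W -> H -> (nnreal R)^o := fun w h => m (i w).1 (h (k (i w).2)).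
  have tt : lhom_test W t.
    exists (fun w => k (i w).2), (fun w => m (i w).1).
    split => //; last first.
      apply: (ctest_comp _ _ (fun w => (i w).1)) tm.
      exact: (measurableT_comp measurable_fst mi).
    apply: (@cpath_comp _ _ _ _ _ k (fun w => (i w).2)) => //.
    exact: (measurableT_comp measurable_snd mi).
  have mt := peta.2 _ _ tt.
  have mjj : measurable_fun [set: (Z * Y) * X] (fun p => (j p.1, p.2)).
    by apply: measurable_fun_pair => //; exact: (measurableT_comp mj measurable_fst).
  apply: eq_measurable_fun (measurableT_comp mt mjj) => p _ /=.
  by rewrite /t ji.
move=> pg tm; have [[M gM] _] := pg.
have Mp : 0 < `|M| + 1 by rewrite ltr_wpDl.
have [a [b [aE bE ba ab]]] := nnreal_inv Mp.
have pbg := cpathZ b pg.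
have bg1 r : cnorm (b *: g r) <= 1.
  rewrite cnormZ bE ler_pdivrMl// mulr1 (le_trans (gM r))//.
  by rewrite (le_trans (ler_norm M))// lerDl.
have ma := @measurable_cst _ _ ((Z * Y) * X)%type R setT (nnval a).
apply: eq_measurable_fun (measurable_funM ma (ball _ pbg bg1 tm)) => p _ /=.
have [ml _] := ctest_dual _ _ tm p.1.1; have [el _ _ _ _] := lhom_bhom (eta p.2).
by rewrite el.1 ml.1 (nnvalM b) mulrA aE bE mulfV ?gt_eqF// mul1r.
Qed.

Lemma lhom_cpath_eval (X : A) (eta : X -> H) x :
  is_cpath eta -> is_cpath (fun r => eta r x).
Proof.
move=> peta; split.
  have [[M etaM] _] := peta; exists (M * cnorm x) => r.
  by rewrite (le_trans (lnorm_le _ _))// ler_wpM2r ?cnorm_ge0//; exact: etaM.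
move=> Z m tm.
have h := lhom_cpath_mf peta (cpath_cst (@ar_one A) x) tm.
have mp : measurable_fun [set: Z * X] (fun p => ((p.1, @ar_pt A), p.2)).
  by apply: measurable_fun_pair => //; exact: measurable_fun_pair.
exact: (measurableT_comp h mp).
Qed.

Let lhom_integral (X : A) (mu : {finite_measure set X -> \bar R})
    (eta : X -> H) : is_cpath eta -> exists f : H, is_cintegral mu eta f.
Proof.
move=> peta.
have [F FE] := choice (fun x =>
  cintegral_ex X mu (fun r => eta r x) (lhom_cpath_eval x peta)).
have el r : clinear (eta r) by case: (lhom_bhom (eta r)).
have pe x := lhom_cpath_eval x peta.
have [[N0 etaN0] _] := peta; pose N := `|N0|.
have etaN r x : cnorm (eta r x) <= N * cnorm x.
  rewrite (le_trans (lnorm_le _ _))// ler_wpM2r ?cnorm_ge0//.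
  by rewrite (le_trans (etaN0 r))// ler_norm.
have Fl : clinear F.
  split=> [a x|x y]; apply: (cintegral_uniq (FE _)).
    have := cintegralZ a (pe x) (FE x); congr is_cintegral.
    by apply/funext => r; rewrite (el r).1.
  have := cintegralD (pe x) (pe y) (FE x) (FE y); congr is_cintegral.
  by apply/funext => r; rewrite (el r).2.
pose M := N * fine (mu setT).
have Nge0 : 0 <= N by exact: normr_ge0.
have M0 : 0 <= M by rewrite /M mulr_ge0// fine_ge0.
have FM x : cnorm (F x) <= M * cnorm x.
  rewrite /M mulrAC; apply: cintegral_norm (FE x) _ => //.
  by rewrite mulr_ge0 ?cnorm_ge0.
have mF (Y Z : A) (g : Y -> C) m : is_cpath g -> ctest D Z m ->
    measurable_fun [set: (Z * Y) * X]
      (fun p => (nnval (m p.1.1 (eta p.2 (g p.1.2))))%:E).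
  by move=> pg tm; apply/measurable_EFinP; exact: (lhom_cpath_mf peta pg tm).
have Fp (Y : A) (g : Y -> C) : is_cpath g -> is_cpath (F \o g).
  move=> pg; split.
    have [[K gK] _] := pg; exists (M * K) => r /=.
    by rewrite (le_trans (FM _))// ler_wpM2l.
  move=> Z m tm; apply/measurable_EFinP.
  have f0 (p : (Z * Y) * X) : (0 <= (nnval (m p.1.1 (eta p.2 (g p.1.2))))%:E)%E.
    by rewrite lee_fin nnval_ge0.
  have h := measurable_fun_fubini_tonelli_F (m2 := mu) _ (mF _ _ _ _ pg tm) f0.
  apply: eq_measurable_fun h => p _ /=.
  by rewrite /fubini_F /= -(FE (g p.2) _ (ctest_pt p.1 tm)).
have hF : is_bhom F.
  split => //.
  - split=> [|u l iu [K uK] ul]; first exact: clinear_mono.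
    have iFu : cincr (F \o u) by exact: ccontinuous_incr.
    have FuK n : cnorm ((F \o u) n) <= M * K.
      by rewrite (le_trans (FM _))// ler_wpM2l.
    have [|w Fw _] := cbound_lub _ iFu FuK.
      by apply: le_trans (FuK 0%N); exact: cnorm_ge0.
    suff -> : F l = w by [].
    apply: (cintegral_uniq (FE l)).
    apply: (@cintegral_club _ _ _ _ mu (fun n r => eta r (u n)) _ (F \o u) _
      (N * K)) => //.
    + by move=> r n; apply: (clinear_mono (el r)); exact: iu.
    + by move=> n r; rewrite (le_trans (etaN _ _))// ler_wpM2l.
    + by move=> r; apply: (ccontinuous_club (lhom_bhom (eta r)) iu ul).
    + by exists (M * K).
  - by exists M.
  - move=> Y nu g x pg gx m tm; rewrite FE//.
    have mf : measurable_fun [set: Y * X]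
        (fun p => (nnval (m ar_pt (eta p.2 (g p.1))))%:E).
      have mp : measurable_fun [set: Y * X] (fun p => ((@ar_pt A, p.1), p.2)).
        by apply: measurable_fun_pair => //; exact: measurable_fun_pair.
      exact: (measurableT_comp (mF _ _ _ _ pg tm) mp).
    transitivity (\int[mu]_r \int[nu]_y (nnval (m ar_pt (eta r (g y))))%:E)%E.
      apply: eq_integral => r _; have [_ _ _ _ ei] := lhom_bhom (eta r).
      exact: (ei _ nu _ _ pg gx m tm).
    have f0 (p : Y * X) : (0 <= (nnval (m ar_pt (eta p.2 (g p.1))))%:E)%E.
      by rewrite lee_fin nnval_ge0.
    have := fubini_tonelli (m1 := nu) (m2 := mu) _ mf f0 => /= <-.
    by apply: eq_integral => y _; rewrite FE.
exists (mk_lhom hF) => _ [g [m [pg g1 tm ->]]].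
exact: (FE (g ar_pt)).
Qed.

HB.instance Definition _ := MCone_isIntegrable.Build R A H lhom_integral.

End lhom_cone.
Arguments lhom_test {R A C D} X.

(** ** Functoriality of the linear hom *)

Section lhom_map.
Variables (R : realType) (A : arities).
Implicit Types B C D : iconeType R A.

Lemma bhom_comp B C D (g : C -> D) (f : B -> C) :
  is_bhom g -> is_bhom f -> is_bhom (g \o f).
Proof.
move=> hg hf; have [gl gc [M M0 gM] gp gi] := hg.
have [fl fc [N N0 fN] fp fi] := hf; split.
- by split=> [a x|x y] /=; [rewrite fl.1 gl.1|rewrite fl.2 gl.2].
- split=> [x y xy|u l iu bu ul] /=; first by apply: gc.1; exact: fc.1.
  apply: (ccontinuous_club hg (u := f \o u)); first exact: ccontinuous_incr.
  exact: fc.2.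
- exists (M * N) => [|x /=]; first by rewrite mulr_ge0.
  by rewrite (le_trans (gM _))// -mulrA ler_wpM2l.
- by move=> X h ph; apply: (gp _ (f \o h)); exact: fp.
- by move=> X mu h x ph hx; apply: (gi _ mu (f \o h)); [exact: fp|exact: fi].
Qed.

Lemma lhom_cintegral C D (X : A) (mu : {finite_measure set X -> \bar R})
    (eta : X -> lhom C D) (f : lhom C D) x : is_cpath eta ->
  is_cintegral mu eta f -> is_cintegral mu (fun r => eta r x) (f x).
Proof.
move=> peta ef; have [y xy] := cintegral_ex X mu _ (lhom_cpath_eval x peta).
suff -> : f x = y by [].
have ball z : cnorm z <= 1 -> is_cintegral mu (fun r => eta r z) (f z).
  by move=> z1 m tm; exact: (ef _ (lhom_test_pt z1 tm)).
have lin (g : lhom C D) : clinear g by case: (lhom_bhom g).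
have [x0|x0] := eqVneq x 0.
  by apply: cintegral_uniq xy; apply: ball; rewrite x0 cnorm0.
have [a [b [aE bE ba ab n1]]] := cnorm_inv x0.
have b1 : cnorm (b *: x) <= 1 by rewrite n1.
apply: cintegral_uniq xy.
have := cintegralZ a (lhom_cpath_eval (b *: x) peta) (ball _ b1).
rewrite -(lin f).1 scalerA ab scale1r; congr is_cintegral.
by apply/funext => r; rewrite -(lin (eta r)).1 scalerA ab scale1r.
Qed.

Section def.
Variables (C C' D D' : iconeType R A) (v : ichom C' C) (w : ichom D D').

Definition lhom_map_fun (f : lhom C D) : lhom C' D' :=
  mk_lhom (bhom_comp (icones_bhom (ichomP w))
             (bhom_comp (lhom_bhom f) (icones_bhom (ichomP v)))).

Lemma lhom_map_funE f x : lhom_map_fun f x = w (f (v x)).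
Proof. by []. Qed.

Lemma lhom_map_norm f : cnorm (lhom_map_fun f) <= cnorm f.
Proof.
have [_ _ vn _ _] := ichomP v; have [wl _ wn _ _] := ichomP w.
apply: lnorm_lub => x x1 /=.
have -> : cnorm f = cnorm f * 1 by rewrite mulr1.
rewrite (le_trans (clinear_norm wl ler01 wn _))// mul1r mulr1.
by apply: (lnorm_ball f); exact: vn.
Qed.

Lemma lhom_map_subproof : is_icones lhom_map_fun.
Proof.
have [vl vc vn vp vi] := ichomP v; have [wl wc wn wp wi] := ichomP w.
split.
- split=> [a f|f g]; apply: lhom_ext => x; first exact: (wl.1 a (f (v x))).
  exact: (wl.2 (f (v x)) (g (v x))).
- have mono f g : cle f g -> cle (lhom_map_fun f) (lhom_map_fun g).
    by move=> fg; apply: lhom_cle => x; apply: wc.1; exact: cle_lhom.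
  split=> // u f iu bu uf; split=> [n|g ug]; first by apply: mono; exact: uf.1.
  apply: lhom_cle => x /=.
  have iux : cincr (fun n => u n (v x)) by move=> n; exact: cle_lhom.
  have h := ccontinuous_club (icones_bhom (ichomP w)) iux (lhom_club iu uf (v x)).
  by apply: h.2 => n; exact: (cle_lhom x (ug n)).
- by move=> f f1; apply: le_trans (lhom_map_norm f) f1.
- move=> X eta peta; have [[M etaM] _] := peta; split.
    by exists M => r; apply: le_trans (lhom_map_norm _) (etaM r).
  move=> Y _ [g [m [pg g1 tm ->]]] /=.
  have pvg := vp _ _ pg.
  have [W [i [j [ij ji mi mj]]]] := ar_prod Y X.
  have pk : is_cpath (fun q : W => eta (i q).2 (v (g (i q).1))).
    split.
      have [[N gN] _] := pvg; exists (M * N) => q.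
      apply: le_trans (lnorm_le _ _) _.
      by apply: ler_pM; [exact: lnorm_ge0|exact: cnorm_ge0|exact: etaM|exact: gN].
    move=> Z m' tm'; have h := lhom_cpath_mf peta pvg tm'.
    have mp : measurable_fun [set: Z * W]
        (fun p => ((p.1, (i p.2).1), (i p.2).2)).
      have mi2 := measurableT_comp mi (@measurable_snd _ _ Z W).
      apply: measurable_fun_pair; last exact: (measurableT_comp measurable_snd mi2).
      apply: measurable_fun_pair => //.
      exact: (measurableT_comp measurable_fst mi2).
    exact: (measurableT_comp h mp).
  have h := (wp _ _ pk).2 _ _ tm.
  have mp : measurable_fun [set: Y * X] (fun p => (p.1, j p)).
    exact: measurable_fun_pair.
  apply: eq_measurable_fun (measurableT_comp h mp) => p _ /=.
  by rewrite ji.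
- move=> X mu eta f peta ef _ [g [m [pg g1 tm ->]]] /=.
  exact: (wi _ mu _ _ (lhom_cpath_eval _ peta) (lhom_cintegral (v (g ar_pt)) peta ef)).
Qed.

Definition lhom_map : ichom (lhom C D) (lhom C' D') := ICHom lhom_map_subproof.

End def.
End lhom_map.

(** ** Tensor products *)

(* A bifunctor [tens_obj, tens_map] such that [tens_obj ^~ C] is left adjoint to
   [lhom C], with [tens_curry] natural in its three arguments. *)
Record tensor (R : realType) (A : arities) := Tensor {
  tens_obj :> iconeType R A -> iconeType R A -> iconeType R A;
  tens_map : forall B B' C C' : iconeType R A,
    ichom B B' -> ichom C C' -> ichom (tens_obj B C) (tens_obj B' C');
  tens_map_id : forall B C : iconeType R A,
    tens_map (ichom_id B) (ichom_id C) = ichom_id (tens_obj B C);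
  tens_map_comp : forall (B B' B'' C C' C'' : iconeType R A)
    (b : ichom B B') (b' : ichom B' B'') (c : ichom C C') (c' : ichom C' C''),
    tens_map (ichom_comp b' b) (ichom_comp c' c) =
    ichom_comp (tens_map b' c') (tens_map b c);
  tens_curry : forall B C D : iconeType R A,
    ichom (tens_obj B C) D -> ichom B (lhom C D);
  tens_curry_bij : forall B C D : iconeType R A,
    bijective (@tens_curry B C D);
  tens_curry_nat : forall (B B' C C' D D' : iconeType R A)
    (b : ichom B' B) (c : ichom C' C) (d : ichom D D')
    (f : ichom (tens_obj B C) D),
    tens_curry (ichom_comp d (ichom_comp f (tens_map b c))) =
    ichom_comp (lhom_map c d) (ichom_comp (tens_curry f) b)
}.

Definition tens (R : realType) (A : arities) (T : tensor R A)
    (B C : iconeType R A) (x : B) (y : C) : T B C :=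
  tens_curry (ichom_id (T B C)) x y.

(* Main.v *)
Require Import Defs.
From mathcomp Require Import all_boot all_order all_algebra.
From mathcomp Require Import all_classical all_reals all_analysis.
From mathcomp Require Import measurable_realfun.

(** The bound [<=] holds because [tens_curry] takes its values in morphisms,
    whose norm is at most 1.  For [>=], a test [m] on [B] yields the bilinear
    map [(x, y) |-> (m x / ||m||) *: y] with values in [C] itself, so that no
    integrable cone structure on the scalars is needed; it factors through
    [T B C] by a morphism of norm at most 1, whence
    [(m x / ||m||) * ||y|| <= ||tens T x y||], and the supremum over [m] of the
    left-hand side is [||x|| * ||y||]. *)

Import Order.TTheory GRing.Theory Num.Theory.

Local Open Scope classical_set_scope.
Local Open Scope ring_scope.

Section rank_one.
Context {R : realType} {A : arities}.

(** The order of [D] need not be detected by tests, so leastness is not checked directly: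
    completeness gives some lub [w], and separation of points identifies it. *)
Lemma club_scalel (D : mconeType R A) (a : nat -> (nnreal R)^o)
    (l : (nnreal R)^o) (e : D) : cincr a -> is_club a l ->
  is_club (fun n => (a n : nnreal R) *: e) ((l : nnreal R) *: e).
Proof.
move=> ia al.
have mono (b c : (nnreal R)^o) :
    cle b c -> cle ((b : nnreal R) *: e) ((c : nnreal R) *: e).
  by move=> [d ->]; exists ((d : nnreal R) *: e); rewrite -scalerDl.
have iae : cincr (fun n => (a n : nnreal R) *: e) by move=> n; exact: mono.
have bae n : cnorm ((a n : nnreal R) *: e) <= cnorm ((l : nnreal R) *: e).
  by apply: cle_cnorm; apply: mono; exact: al.1.
have [w aw _] := cbound_lub (cnorm_ge0 _) iae bae.
suff -> : (l : nnreal R) *: e = w by [].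
(* Each test of [D] at [e] reduces the equality to a supremum of scalars. *)
apply: (ctest_sep (s := D)) => m tm; have [ml mc] := ctest_dual _ _ tm ar_pt.
have bd : cbounded (fun n => (a n : nnreal R) *: e).
  by exists (cnorm ((l : nnreal R) *: e)).
apply: club_uniq (mc.2 _ _ iae bd aw).
(* By commutativity, [m ar_pt e] becomes the fixed scalar and [a] the sequence. *)
have := clubZ (m ar_pt e) al; rewrite ml.1.
rewrite [_ *: l](mulrC (m ar_pt e : nnreal R)).
congr is_club; apply/funext => n /=.
by rewrite ml.1 [LHS](mulrC (m ar_pt e : nnreal R)).
Qed.

(** A test [p] of [D] turns the map into the product of [m ar_pt x] and [p] at [e], so measurability
    and integrals reduce to the scalar case. *)
Lemma rank_one_icones (B D : iconeType R A) (m : ar_one -> B -> (nnreal R)^o)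
    (e : D) : ctest B ar_one m -> copnorm (m ar_pt) * cnorm e <= 1 ->
  is_icones (fun x : B => (m ar_pt x : nnreal R) *: e).
Proof.
move=> tm me; have [ml mc] := ctest_dual _ _ tm ar_pt; split.
- by split=> [a x|x y]; rewrite ?ml.1 ?ml.2 ?scalerA ?scalerDl.
- split=> [x y /mc.1 [z ->]|u l iu bu ul].
    by exists ((z : nnreal R) *: e); rewrite scalerDl.
  apply: (@club_scalel _ (m ar_pt \o u)); last exact: mc.2.
  by move=> n; apply: mc.1; exact: iu.
- move=> x x1; rewrite cnormZ; apply: le_trans me.
  rewrite ler_wpM2r ?cnorm_ge0// (le_trans (ctest_copnorm x tm))//.
  by rewrite ler_piMr ?ctest_copnorm_ge0.
- move=> X g pg; have [[M gM] _] := pg; split.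
    exists (M * cnorm e) => r /=; rewrite cnormZ ler_wpM2r ?cnorm_ge0//.
    exact: le_trans (ctest_le _ (g r) tm) (gM r).
  move=> Y p tp.
  have h1 := measurableT_comp (cpath_mf pg tm) (@measurable_snd _ _ Y X).
  have h2 := measurableT_comp (ctest_mf e tp) (@measurable_fst _ _ Y X).
  apply: eq_measurable_fun (measurable_funM h1 h2) => q _ /=.
  have [pl _] := ctest_dual _ _ tp q.1.
  by rewrite pl.1 [in RHS]nnvalM.
- move=> X mu g x pg gx p tp; have [pl _] := ctest_dual _ _ tp ar_pt.
  rewrite pl.1 [nnval _]nnvalM mulrC EFinM (gx m)// -ge0_integralZl//=.
  + apply: eq_integral => r _.
    by rewrite pl.1 [in RHS]nnvalM mulrC EFinM.
  + exact: cpath_emf.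
  + by move=> r _; rewrite lee_fin nnval_ge0.
  + by rewrite lee_fin nnval_ge0.
Qed.

End rank_one.

Section tensor_theory.
Context {R : realType} {A : arities} (T : tensor R A).
Implicit Types B C D : iconeType R A.

(** Yoneda argument: naturality in the codomain, applied to the identity of [T B C]. *)
Lemma tens_curry_tens B C D (h : ichom (T B C) D) (x : B) (y : C) :
  tens_curry h x y = h (tens T x y).
Proof.
have := tens_curry_nat (ichom_id B) (ichom_id C) h (ichom_id (T B C)).
rewrite tens_map_id => nat_h.
have -> : h = ichom_comp h (ichom_comp (ichom_id (T B C)) (ichom_id (T B C))).
  exact: ichom_ext.
by rewrite nat_h.
Qed.

Lemma ichom_norm C D (f : ichom C D) (x : C) : cnorm (f x) <= cnorm x.
Proof.
have [fl _ fn _ _] := ichomP f.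
by apply: le_trans (clinear_norm fl ler01 fn x) _; rewrite mul1r.
Qed.

Lemma tens_norm_universal B C D (f : ichom B (lhom C D)) (x : B) (y : C) :
  cnorm (f x y) <= cnorm (tens T x y).
Proof.
have [g _ gK] := tens_curry_bij T B C D.
by rewrite -(gK f) tens_curry_tens; exact: ichom_norm.
Qed.

Lemma ctest_tens_norm B C (m : ar_one -> B -> (nnreal R)^o) (x : B) (y : C) :
  ctest B ar_one m ->
  nnval (m ar_pt x) * cnorm y <= cnorm (tens T x y) * copnorm (m ar_pt).
Proof.
(* When [m] has norm 0 it cannot be normalised, but then it vanishes at [x]. *)
move=> tm; have [m0|m0] := eqVneq (copnorm (m ar_pt)) 0.
  rewrite m0 mulr0 mulr_le0_ge0 ?cnorm_ge0//.
  by apply: le_trans (ctest_copnorm x tm) _; rewrite m0 mul0r.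
have mp : 0 < copnorm (m ar_pt) by rewrite lt_neqAle eq_sym m0 ctest_copnorm_ge0.
have [a [b [aE bE ba ab]]] := nnreal_inv mp.
(* The vector [e] of the rank-one map is the identity of [C] scaled by [b], the inverse of the norm
   of [m]. The identity has norm 0 if [C] is trivial, hence only the bound by 1. *)
pose id_lhom : lhom C C := mk_lhom (icones_bhom (is_icones_id C)).
have id1 : cnorm id_lhom <= 1 by exact: lnorm_lub.
have me : copnorm (m ar_pt) * cnorm (b *: id_lhom) <= 1.
  by rewrite cnormZ bE mulVKf.
pose f := ICHom (rank_one_icones _ _ m _ tm me).
have := tens_norm_universal _ _ _ f x y.
rewrite -[f x y]/((m ar_pt x : nnreal R) *: (b *: y)) !cnormZ bE.
by rewrite mulrCA mulrC ler_pdivrMr.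
Qed.

End tensor_theory.

Theorem theorem5p13 (R : realType) (A : arities) (T : tensor R A)
  (B C : iconeType R A) (x : B) (y : C) :
  cnorm (tens T x y) = cnorm x * cnorm y.
Proof.
apply/eqP; rewrite eq_le; apply/andP; split.
  apply: le_trans (lnorm_le _ y) _; rewrite ler_wpM2r ?cnorm_ge0//.
  exact: ichom_norm.
have [y0|y0] := eqVneq (cnorm y) 0; first by rewrite y0 mulr0 cnorm_ge0.
have yp : 0 < cnorm y by rewrite lt_neqAle eq_sym y0 cnorm_ge0.
(* Dividing by the norm of [y] leaves the norm of [x] alone, where the supremum over tests
   applies. *)
rewrite -ler_pdivlMr//; apply: cnorm_le_ctest => [|m tm].
  by rewrite divr_ge0 ?cnorm_ge0.
by rewrite mulrAC ler_pdivlMr//; exact: ctest_tens_norm.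
Qed.
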